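(* Let $\kappa\le\theta$ be uncountable cardinals. The following are equivalent: (1) There exists a topological space $X$ that is first countable, $<\!\kappa$-collectionwise Hausdorff and not weakly $\theta$-collectionwise Hausdorff. (2) There exists a family $\mathcal{H}=\{H_{\alpha\beta}:\alpha<\beta<\theta\}\subseteq[\omega\times\omega]^{<\omega}$, with each $H_{\alpha\beta}$ closed downward, such that (a) for every $A\in[\theta]^{<\kappa}$ there is a function $f:\theta\to\omega$ such that for all $\alpha<\beta$ in $A$, $(f(\alpha),f(\beta))\notin H_{\alpha\beta}$; and (b) for every $B\in[\theta]^{\theta}$ and every $f:\theta\to\omega$ there are $\alpha<\beta$ in $B$ such that $(f(\alpha),f(\beta))\in H_{\alpha\beta}$. (3) There exists a topological space $X$ that is first countable, zero-dimensional, $<\!\kappa$-collectionwise Hausdorff and not weakly $\theta$-collectionwise Hausdorff.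
   Context: A subset $A$ of a topological space $X$ can be separated if there is a family $\{U_x:x\in A\}$ of pairwise disjoint open sets with $x\in U_x$ for each $x\in A$. $X$ is $<\!\kappa$-collectionwise Hausdorff if every closed discrete subset of size $<\kappa$ can be separated. A subset $A$ is weakly separated if some subset of $A$ of cardinality $|A|$ can be separated; $X$ is weakly $\theta$-collectionwise Hausdorff if every closed discrete subset of $X$ of cardinality $\theta$ is weakly separated. A set $H\subseteq\omega\times\omega$ is closed downward if whenever $(n,m)\in H$, $n'\le n$ and $m'\le m$, then $(n',m')\in H$. $[\omega\times\omega]^{<\omega}$ denotes the finite subsets of $\omega\times\omega$. *)

(* Defs.v *)
From HB Require Import structures.
From mathcomp Require Import all_boot all_order.
From mathcomp Require Import mathcomp_extra boolp classical_sets functions.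
From mathcomp Require Import cardinality wochoice filter topology.

Set Implicit Arguments.
Unset Strict Implicit.
Unset Printing Implicit Defensive.

Import Order.TTheory.

Local Open Scope classical_set_scope.
Local Open Scope card_scope.

Definition card_lt {T U : Type} (A : set T) (B : set U) : Prop :=
  (A #<= B) /\ ~ (A #= B).

(** A cardinal is an initial ordinal: a well-ordered type all of whose proper
    initial segments have strictly smaller cardinality. *)
Definition initial_ordinal {d : Order.disp_t} (T : orderType d) : Prop :=
  well_order (<=%O : rel T) /\
  forall b : T, card_lt [set a : T | (a < b)%O] [set: T].

Section Topology.
Context {X : topologicalType}.
Implicit Types A B : set X.

Definition separated_points A : Prop :=
  exists U : X -> set X,
    (forall x, A x -> open_nbhs x (U x)) /\ trivIset A U.

(** Some subset of [A] of the same cardinality as [A] can be separated. *)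
Definition weakly_separated_points A : Prop :=
  exists B, [/\ B `<=` A, B #= A & separated_points B].

(** [A `<=` isolated A] says that the subspace topology on [A] is discrete. *)
Definition closed_discrete A : Prop := closed A /\ A `<=` isolated A.

End Topology.

Definition first_countable (X : topologicalType) : Prop :=
  forall x : X, exists2 B : set (set X),
    countable B & B `<=` open_nbhs x /\ filter_from B id --> x.

(** The library's [zero_dimensional] only asks that clopen sets separate
    points, which is weaker on Hausdorff spaces than having a clopen basis. *)
Definition has_clopen_basis (X : topologicalType) : Prop :=
  exists2 B : set (set X), B `<=` clopen & basis B.

(** In the next two definitions the type [K] only serves as a cardinal. *)
Definition lt_collectionwise_hausdorff (K : Type) (X : topologicalType) :
    Prop :=
  forall A : set X,
    closed_discrete A -> card_lt A [set: K] -> separated_points A.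

Definition weakly_collectionwise_hausdorff (K : Type) (X : topologicalType) :
    Prop :=
  forall A : set X,
    closed_discrete A -> A #= [set: K] -> weakly_separated_points A.

Definition closed_downward (H : set (nat * nat)) : Prop :=
  forall n m n' m' : nat,
    H (n, m) -> (n' <= n)%N -> (m' <= m)%N -> H (n', m').

(* Main.v *)
Require Import Defs.
From HB Require Import structures.
From mathcomp Require Import all_boot all_order.
From mathcomp Require Import mathcomp_extra boolp classical_sets functions.
From mathcomp Require Import cardinality wochoice filter topology.

Import Order.TTheory.

Local Open Scope classical_set_scope.
Local Open Scope card_scope.

(* From (1) to (2): index a closed discrete set that is not weakly separated by
   theta, and let [H a b] be the set of pairs (n, m) for which the n-th basic
   neighbourhood of the point a meets the m-th one of the point b.  Countable
   subsets being separated, the bases can be shrunk so that the 0-th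
   neighbourhood of a point has no other point in its closure, and this makes
   every [H a b] finite.  From (2) to (3): take theta together with isolated
   points (a, b, (n, m)) for (n, m) in [H a b], the k-th neighbourhood of a
   vertex consisting of the edges at it with corresponding coordinate at least
   k.  The n-th neighbourhood of a then meets the m-th one of b iff (n, m) is in
   [H a b], and finiteness makes these neighbourhoods clopen. *)

(** * Cardinal comparisons and bounds for finite sets of pairs *)

Lemma card_le_lt_trans {T U V : Type} {A : set T} {B : set U} {C : set V} :
  A #<= B -> card_lt B C -> card_lt A C.
Proof.
move=> AB [BC nBC]; split; first exact: card_le_trans AB BC.
move=> /card_eqPle[_ CA]; apply: nBC.
exact: Cantor_Bernstein BC (card_le_trans CA AB).
Qed.

Lemma countable_card_lt {T U : Type} {A : set T} {C : set U} :
  countable A -> ~ countable C -> card_lt A C.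
Proof.
move=> cA ncC; split; last by move=> /eq_countable eAC; apply: ncC; rewrite -eAC.
apply: card_le_trans cA _; apply: contrapT => /finite_setPn.
by move=> /finite_set_countable.
Qed.

Lemma card_eqT_inj {T U : Type} {A : set U} :
  A #= [set: T] -> exists2 f : T -> U, injective f & range f = A.
Proof.
move=> /card_esym/card_bijP[g [h gK hK]].
exists (fun t => \val (g (SigSub (mem_setT t)))).
  by move=> s t /val_inj/(can_inj gK)[].
apply/seteqP; split=> [_ [t _ <-]|u Au]; first exact/set_mem/valP.
exists (\val (h (SigSub (mem_set Au)))) => //.
have -> : SigSub (mem_setT (\val (h (SigSub (mem_set Au))))) =
  h (SigSub (mem_set Au)) by exact: val_inj.
by rewrite hK.
Qed.

Lemma finite_pairs_bounded (H : set (nat * nat)) :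
  finite_set H -> exists N, forall n m, H (n, m) -> (n < N /\ m < N)%N.
Proof.
move=> /finite_seqP[s Hs].
exists (\max_(p <- s) maxn p.1 p.2).+1 => n m Hnm; rewrite !ltnS.
have: (maxn n m <= \max_(p <- s) maxn p.1 p.2)%N.
  rewrite Hs /= in Hnm.
  exact: (@leq_bigmax_seq _ s xpredT (fun p => maxn p.1 p.2) (n, m)).
by rewrite geq_max => /andP.
Qed.

(** * Closed discrete sets and decreasing neighbourhood bases *)

Section ClosedDiscrete.
Context {X : topologicalType}.
Implicit Types A B : set X.

(** Isolation at points of [A] and closedness at the others merge into one local condition.
    Conversely, a neighbourhood of a closure point [x] must meet [A], and [V] can only do so in [x]
    itself. *)
Lemma closed_discreteP A :
  closed_discrete A <->
  forall x, exists2 V, nbhs x V & V `&` A `<=` [set x].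
Proof.
split=> [[cA iA] x|iA].
  have [Ax|nAx] := pselect (A x).
    by have [_ [V Vx VA]] := iA _ Ax; exists V; rewrite ?VA.
  exists (~` A); last by move=> y [].
  by apply: open_nbhs_nbhs; split=> //; exact: closed_openC.
split=> [x clx|x Ax].
  have [V Vx VA] := iA x.
  by have [y [Ay Vy]] := clx _ Vx; rewrite -(VA y).
split; first exact/mem_set.
have [V Vx VA] := iA x; exists V => //; apply/seteqP; split=> // y ->.
by split=> //; exact: nbhs_singleton.
Qed.

Lemma sub_closed_discrete A B :
  A `<=` B -> closed_discrete B -> closed_discrete A.
Proof.
move=> AB /closed_discreteP dB; apply/closed_discreteP => x.
have [V Vx VB] := dB x; exists V => // y [Vy Ay]; apply: VB.
by split=> //; exact: AB.
Qed.

(** Indexing by [nat] lets one function [X -> nat] encode a choice of neighbourhoods; as these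
    decrease, the pairs of indices whose neighbourhoods meet form a downward closed set. *)
Definition decreasing_nbhs_bases (U : X -> nat -> set X) :=
  [/\ forall x n, open_nbhs x (U x n),
      forall x m n, (m <= n)%N -> U x n `<=` U x m &
      forall x O, nbhs x O -> exists n, U x n `<=` O].

Lemma first_countable_bases :
  first_countable X -> exists U, decreasing_nbhs_bases U.
Proof.
move=> fX.
suff /choice[U PU] : forall x : X, exists U : nat -> set X,
    [/\ forall n, open_nbhs x (U n),
        forall m n, (m <= n)%N -> U n `<=` U m &
        forall O, nbhs x O -> exists n, U n `<=` O].
  by exists U; split=> x *; have [h1 h2 h3] := PU x; auto.
move=> x; have [B cB [Bo Bx]] := fX x.
(* [B] is nonempty, so it is the range of a sequence. *)
have [b0 Bb0 _] : filter_from B id setT by apply: Bx; exact: filterT.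
have [e eB] : exists e : nat -> set X, range e = B.
  have [B0|[e]] := pfcard_geP cB; first by rewrite B0 in Bb0.
  by exists e; apply/seteqP; split=> [_ [n _ <-]|b /(@surj _ _ _ _ e)[n _ <-]];
    [exact: funS | exists n].
have eo n : open_nbhs x (e n) by apply: Bo; rewrite -eB; exists n.
(* Intersecting initial segments makes the sequence decrease; including the index [n] keeps the
   [n]-th set inside [e n]. *)
exists (fun n => \bigcap_(i in `I_n.+1) e i); split.
- move=> n; split; last by move=> i _; exact: (eo i).2.
  elim: n => [|n IHn]; first by rewrite II1 bigcap_set1; exact: (eo 0%N).1.
  by rewrite IIS bigcap_setU bigcap_set1; apply: openI => //; exact: (eo _).1.
- by move=> m n mn y Uy i /= im; apply: Uy; exact: leq_trans im _.
- move=> O /Bx[b]; rewrite -eB => -[n _ <-] enO; exists n.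
  by move=> y Uy; apply: enO; exact: (Uy n (ltnSn n)).
Qed.

Lemma bases_first_countable U : decreasing_nbhs_bases U -> first_countable X.
Proof.
move=> [Uo Ud Ub] x; exists (range (U x)).
  exact: sub_countable (card_image_le _ _) (countableP _).
split=> [_ [n _ <-]|O /Ub[n UO]]; first exact: Uo.
by exists (U x n) => //; exists n.
Qed.

Lemma shift_bases U (m : X -> nat) :
  decreasing_nbhs_bases U ->
  decreasing_nbhs_bases (fun x n => U x (m x + n)).
Proof.
move=> [Uo Ud Ub]; split=> [x n|x i j ij|x O /Ub[n UO]]; first exact: Uo.
  by apply: Ud; rewrite leq_add2l.
by exists n; apply: subset_trans UO; apply: Ud; rewrite leq_addl.
Qed.

(** Separating open sets shrink to basic ones, so separation amounts to choosing one index per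
    point. *)
Lemma separated_pointsP U A : decreasing_nbhs_bases U ->
  separated_points A <-> exists f : X -> nat, trivIset A (fun x => U x (f x)).
Proof.
move=> [Uo Ud Ub]; split=> [[V [Vo Vd]]|[f fd]]; last first.
  by exists (fun x => U x (f x)); split.
have /choice[f Uf] : forall x, exists n, A x -> U x n `<=` V x.
  move=> x; have [/Vo Vx|nAx] := pselect (A x); last by exists 0%N.
  by have [n Un] := Ub x _ (open_nbhs_nbhs Vx); exists n.
exists f => x y Ax Ay [z [/Uf zx /Uf zy]]; apply: Vd => //.
by exists z; split; [exact: zx|exact: zy].
Qed.

(* If every [U x m] had a point [y m] of [A] in its closure, then the countable
   set of the [y m] and [x] could not be separated. *)
Lemma countably_separated_bases A :
  first_countable X ->
  (forall B, B `<=` A -> countable B -> separated_points B) ->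
  exists2 U, decreasing_nbhs_bases U &
    forall x y, A x -> A y -> x <> y -> exists n, U x 0%N `&` U y n = set0.
Proof.
move=> /first_countable_bases[U Ubase] sepA; have [Uo Ud Ub] := Ubase.
suff /choice[m mP] : forall x, exists m, A x -> forall y, A y -> x <> y ->
    exists n, U x m `&` U y n = set0.
  exists (fun x n => U x (m x + n)%N); first exact: shift_bases.
  move=> x y Ax Ay xy; have [n Un] := mP x Ax y Ay xy.
  exists n; rewrite addn0 -subset0 -Un; apply: setIS.
  by apply: Ud; exact: leq_addl.
move=> x; apply: contrapT => /forallNP H.
have /choice[y yP] : forall m, exists y, [/\ A x, A y, x <> y &
    forall n, U x m `&` U y n !=set0].
  move=> m; apply: contrapT => /forallNP Hm; apply: (H m) => Ax y Ay xy.
  apply: contrapT => /forallNP Hn; apply: (Hm y); split=> // n.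
  exact/set0P/eqP/Hn.
pose z n := if n is k.+1 then y k else x.
have /(separated_pointsP _ _ Ubase)[f fd] : separated_points (range z).
  apply: sepA; last exact: sub_countable (card_image_le _ _) (countableP _).
  by move=> _ [[|k] _ <-] /=; [have [] := yP 0%N|have [] := yP k].
(* The index [f x] itself tells which point to take: [U x (f x)] meets every basic neighbourhood of
   [y (f x)]. *)
have [_ _ xy /(_ (f (y (f x))))xyU] := yP (f x).
by apply: xy; apply: fd => //; [exists 0%N|exists (f x).+1].
Qed.

End ClosedDiscrete.

(* [G] only selects the topology: the edges [inr (a, b, (n, m))] with [(n, m)]
   outside [G a b] are harmless isolated points in no star. *)
Definition edge_space (T : choiceType) (G : T -> T -> set (nat * nat)) : Type :=
  (T + T * T * (nat * nat))%type.

(** * The space of vertices and edges *)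

Section EdgeSpace.
Context {T : choiceType}.
Variable G : T -> T -> set (nat * nat).
Local Notation E := (edge_space T G).

Definition vertex (a : T) : E := inl a.

Definition star (a : T) (k : nat) : set E := fun z =>
  match z with
  | inl b => b = a
  | inr (b, c, (n, m)) =>
      G b c (n, m) /\ (b = a /\ (k <= n)%N \/ c = a /\ (k <= m)%N)
  end.

Lemma star_sub a j k : (j <= k)%N -> star a k `<=` star a j.
Proof.
move=> jk [b|[[b c] [n m]]] //= [Gbc [[ba kn]|[ca km]]]; split=> //;
  [left|right]; split=> //; exact: leq_trans jk _.
Qed.

(** Only vertices are constrained, so every edge is an isolated point. *)
Definition star_open (O : set E) : Prop :=
  forall a, O (vertex a) -> exists k, star a k `<=` O.

Lemma star_openT : star_open setT.
Proof. by move=> a _; exists 0%N. Qed.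

Lemma star_openI : setI_closed star_open.
Proof.
move=> O1 O2 o1 o2 a [/o1[j jO] /o2[k kO]]; exists (maxn j k) => z az.
split; [apply: jO|apply: kO]; apply: star_sub az;
  [exact: leq_maxl|exact: leq_maxr].
Qed.

Lemma star_open_bigcup (I : Type) (f : I -> set E) :
  (forall i, star_open (f i)) -> star_open (\bigcup_i f i).
Proof.
move=> of_ a [i _ fia]; have [k kO] := of_ i a fia; exists k.
by apply: subset_trans kO _ => z fz; exists i.
Qed.

HB.instance Definition _ := Choice.on E.
HB.instance Definition _ := isOpenTopological.Build E
  star_openT star_openI star_open_bigcup.

Lemma edge_space_openE (O : set E) : open O = star_open O.
Proof. by []. Qed.

Definition edge_base (z : E) (k : nat) : set E :=
  if z is inl a then star a k else [set z].

Lemma edge_baseP : decreasing_nbhs_bases edge_base.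
Proof.
split=> [[a|e] n|[a|e] m n mn|[a|e] O].
- by split=> //; rewrite edge_space_openE => b -> ; exists n.
- by split=> //; rewrite edge_space_openE.
- exact: star_sub.
- by [].
- rewrite nbhsE => -[V [Vo Va] VO]; rewrite edge_space_openE in Vo.
  by have [k kV] := Vo a Va; exists k => z /kV/VO.
- by move=> /nbhs_singleton Oe; exists 0%N => _ ->.
Qed.

Lemma star_meetl a b n m :
  G a b (n, m) -> star a n `&` star b m !=set0.
Proof.
by move=> Gab; exists (inr (a, b, (n, m))); split; split=> //; [left|right].
Qed.

Lemma edge_baseD1 z A : closed_discrete A ->
  exists k, edge_base z k `&` A `<=` [set z].
Proof.
move=> /closed_discreteP/(_ z)[V Vz VA].
have [_ _ /(_ _ _ Vz)[k kV]] := edge_baseP.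
by exists k => y [/kV Vy Ay]; apply: VA.
Qed.

Lemma closed_discrete_vertices : closed_discrete (range vertex).
Proof.
apply/closed_discreteP => z; exists (edge_base z 0%N).
  by apply: open_nbhs_nbhs; have [] := edge_baseP.
by case: z => [a|e] y [] /= zy [b _ yb]; move: zy; rewrite -yb //= => ->.
Qed.

(** The set of all vertices is the counterexample: separating a subset of full size would give an
    index function [f], but the edge from some [a] to some [b] labelled [(f a, f b)] lies in both
    stars. *)
Lemma not_weakly_cwh_edge_space :
  (forall B : set T, B #= [set: T] -> forall f : T -> nat,
     exists a b, [/\ B a, B b, a <> b & G a b (f a, f b)]) ->
  ~ weakly_collectionwise_hausdorff T E.
Proof.
move=> GB; have vinj : injective vertex by move=> a b [].
have vcard (B : set T) : vertex @` B #= B by apply: inj_card_eq => ? ? _ _ /vinj.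
move=> /(_ _ closed_discrete_vertices (vcard _))[B [Bv cB]].
move=> /(separated_pointsP _ _ edge_baseP)[f fd].
have BE : vertex @` (vertex @^-1` B) = B.
  by apply/seteqP; split=> [_ [a Ba <-]|z Bz] //; have [a _ az] := Bv z Bz;
    exists a; rewrite //= az.
have cB' : vertex @^-1` B #= [set: T].
  apply: card_eq_trans (card_esym (vcard _)) _; rewrite BE.
  exact: card_eq_trans cB (vcard _).
have [a [b [Ba Bb ab Gab]]] := GB _ cB' (f \o vertex).
by apply: ab; apply: vinj; apply: fd => //; exact: star_meetl.
Qed.

Hypothesis G_down : forall a b, closed_downward (G a b).

(** A common point cannot be a vertex, so it is an edge joining [a] and [b]. Its label dominates the
    two indices, in an order given by its orientation, and [G_down] applies. *)
Lemma star_meet a b n m : a <> b -> star a n `&` star b m !=set0 ->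
  G a b (n, m) \/ G b a (m, n).
Proof.
move=> ab [[c|[[c d] [i j]]] []]; first by move=> /= -> /ab.
move=> [Gcd ca] [_ cb].
case: ca cb => -[? ni] [] [? mj]; subst=> //; [left|right];
  exact: (G_down _ _ _ _ _ _ Gcd).
Qed.

(** [A] may contain edges as well as vertices: [f] keeps the stars of its vertices apart, and [g]
    keeps them off the edges in [A]. *)
Lemma lt_cwh_edge_space (K : Type) :
  (forall A : set T, card_lt A [set: K] -> exists f : T -> nat,
     forall a b, A a -> A b -> ~ G a b (f a, f b)) ->
  lt_collectionwise_hausdorff K E.
Proof.
move=> GA A dA cA.
have cA' : card_lt (vertex @^-1` A) [set: K].
  apply: card_le_lt_trans cA.
  have /card_eqPle[_ le] : vertex @` (vertex @^-1` A) #= vertex @^-1` A.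
    by apply: inj_card_eq => a b _ _ [].
  apply: card_le_trans le _; apply: subset_card_le => _ [a Aa <-] //.
have [f fP] := GA _ cA'.
have /choice[g gP] : forall a, exists k,
  star a k `&` A `<=` [set vertex a] by move=> a; exact: (edge_baseD1 (vertex a) _ dA).
apply/(separated_pointsP _ _ edge_baseP).
(* The basic sets of an edge are all its singleton, so any index serves there. *)
pose h (z : E) := if z is inl a then maxn (f a) (g a) else 0%N.
have hf a : star a (h (vertex a)) `<=` star a (f a).
  by apply: star_sub; exact: leq_maxl.
have hg a e : A (inr e) -> ~ star a (h (vertex a)) (inr e).
  move=> Ae he; suff : [set vertex a] (inr e) by [].
  by apply: gP; split=> //; apply: star_sub he; exact: leq_maxr.
exists h => -[a|e] [b|e'] Aa Ab [z [az bz]].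
- apply: contrapT => ab; have /star_meet : a <> b by move=> E; rewrite E in ab.
  move=> /(_ (f a) (f b))[]; first by exists z; split; exact: hf.
    exact: fP.
  exact: fP.
- by move: bz az => -> /(hg _ _ Ab).
- by move: az bz => -> /(hg _ _ Aa).
- by rewrite -az -bz.
Qed.

Hypothesis G_finite : forall a b, finite_set (G a b).

(** Only finitely many labels join [a] to another vertex [b], so a far enough star of [b] avoids
    [star a k]; hence the complement is open. *)
Lemma clopen_edge_base z k : clopen (edge_base z k).
Proof.
have [Bo _ _] := edge_baseP; split; first exact: (Bo z k).1.
rewrite -[edge_base z k]setCK; apply: open_closedC.
rewrite edge_space_openE => b.
case: z => [a /= nab|[[c d] [i j]] _]; last first.
  (* An index above both coordinates excludes this edge, whichever end [b] is. *)
  exists (maxn i j).+1 => -[//|e] eb ecd; move: eb; rewrite ecd /=.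
  by move=> [_ [] [_]]; rewrite gtn_max ltnn ?andbF // => /andP[]; rewrite ltnn.
have [N NP] := finite_pairs_bounded _ (G_finite a b).
have [M MP] := finite_pairs_bounded _ (G_finite b a).
exists (maxn N M) => z bz az.
have /star_meet : a <> b by move=> ab; apply: nab; rewrite ab.
move=> /(_ k (maxn N M))[]; first by exists z.
  by move=> /NP[_]; rewrite gtn_max ltnn.
by move=> /MP[]; rewrite gtn_max ltnn andbF.
Qed.

Lemma edge_space_clopen_basis : has_clopen_basis E.
Proof.
have [Bo _ Bb] := edge_baseP; exists clopen => //; split=> [V []//|z O /Bb[k kO]].
exists (edge_base z k) => //; split; [exact: clopen_edge_base|exact: (Bo z k).2].
Qed.

End EdgeSpace.

Theorem theorem2 (dk dt : Order.disp_t)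
    (kappa : orderType dk) (theta : orderType dt)
    (kappa_card : initial_ordinal kappa) (theta_card : initial_ordinal theta)
    (kappa_uncountable : ~ countable [set: kappa])
    (theta_uncountable : ~ countable [set: theta])
    (kappa_le_theta : [set: kappa] #<= [set: theta]) :
  [<->
    (exists X : topologicalType,
       [/\ first_countable X,
           lt_collectionwise_hausdorff kappa X &
           ~ weakly_collectionwise_hausdorff theta X]);
    (exists H : theta -> theta -> set (nat * nat),
       [/\ (forall a b : theta, (a < b)%O ->
              finite_set (H a b) /\ closed_downward (H a b)),
           (forall A : set theta, card_lt A [set: kappa] ->
              exists f : theta -> nat,
                forall a b : theta, A a -> A b -> (a < b)%O ->
                  ~ H a b (f a, f b)) &
           (forall B : set theta, B #= [set: theta] ->
              forall f : theta -> nat,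
                exists a b : theta,
                  [/\ B a, B b, (a < b)%O & H a b (f a, f b)])]);
    (exists X : topologicalType,
       [/\ first_countable X,
           has_clopen_basis X,
           lt_collectionwise_hausdorff kappa X &
           ~ weakly_collectionwise_hausdorff theta X])].
Proof.
tfae.
- move=> [X [fX lX nwX]].
  have [A [dA cA nsA]] : exists A : set X,
      [/\ closed_discrete A, A #= [set: theta] & ~ weakly_separated_points A].
    apply: contrapT => /forallNP nA; apply: nwX => A dA cA.
    by apply: contrapT => nsA; apply: (nA A).
  have [x xinj xA] := card_eqT_inj cA.
  have Ax a : A (x a) by rewrite -xA; exists a.
  have sepA B : B `<=` A -> card_lt B [set: kappa] -> separated_points B.
    by move=> BA; apply: lX; exact: sub_closed_discrete dA.
  have [U Ubase Usep] : exists2 U, decreasing_nbhs_bases U &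
      forall y z, A y -> A z -> y <> z -> exists n, U y 0%N `&` U z n = set0.
    (* Since [kappa] is uncountable, countable subsets of [A] are small enough to be separated. *)
    apply: countably_separated_bases => // B BA cB.
    by apply: sepA => //; exact: countable_card_lt.
  have [_ Ud _] := Ubase.
  exists (fun a b => [set p | U (x a) p.1 `&` U (x b) p.2 !=set0]); split.
  + move=> a b ab; split; last first.
      move=> n m n' m' [z [zn zm]] nn' mm'; exists z.
      by split; [exact: Ud zn|exact: Ud zm].
    have xab : x a <> x b by move=> /xinj E; rewrite E ltxx in ab.
    (* As neighbourhoods decrease, a pair [(n, m)] whose neighbourhoods meet has [m < N] by the
       first disjointness and [n < M] by the second. *)
    have [N NE] := Usep _ _ (Ax a) (Ax b) xab.
    have [M ME] := Usep _ _ (Ax b) (Ax a) (nesym xab).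
    apply: sub_finite_set (finite_setX (finite_II M) (finite_II N)).
    move=> [n m] /= [z [zn zm]]; split=> /=; rewrite ltnNge; apply/negP => le.
      by suff : set0 z by []; rewrite -ME; split; [exact: Ud zm|exact: Ud zn].
    by suff : set0 z by []; rewrite -NE; split; [exact: Ud zn|exact: Ud zm].
  + move=> B cB; have : separated_points (x @` B).
      apply: sepA => [_ [a _ <-] //|].
      by apply: card_le_lt_trans cB; exact: card_image_le.
    move=> /(separated_pointsP _ _ Ubase)[f fd]; exists (f \o x) => a b Ba Bb ab.
    move=> /(fd _ _ (imageP _ Ba) (imageP _ Bb))/xinj E.
    by rewrite E ltxx in ab.
  + move=> B cB f; apply: contrapT => nB; apply: nsA.
    have xcard (C : set theta) : x @` C #= C.
      by apply: inj_card_eq => ? ? _ _ /xinj.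
    exists (x @` B); split; first by move=> _ [a _ <-].
      exact: card_eq_trans (xcard B) (card_eq_trans cB (card_esym cA)).
    (* A separation is indexed by points of [X], so [f] is transported along [x]; [g] is
       unconstrained off the range. *)
    have /choice[g gx] : forall y, exists n, forall a, x a = y -> f a = n.
      move=> y; have [[a ay]|nay] := pselect (exists a, x a = y).
        by exists (f a) => b; rewrite -ay => /xinj ->.
      by exists 0%N => a ay; case: nay; exists a.
    apply/(separated_pointsP _ _ Ubase); exists g.
    move=> _ _ [a Ba <-] [b Bb <-]; rewrite -(gx _ a)// -(gx _ b)// => ne.
    (* Meeting is symmetric, so the pair can be put in increasing order to contradict [nB]. *)
    have [ab|ba|->//] := ltgtP a b; case: nB.
      by exists a, b.
    by exists b, a; split=> //; rewrite /= setIC.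
- move=> [H [Hfd HA HB]].
  (* [H] is controlled only for [a < b]; elsewhere [G] is empty, so finiteness and downward closure
     hold for all pairs. *)
  pose G (a b : theta) := [set p | (a < b)%O /\ H a b p].
  have Gd a b : closed_downward (G a b).
    by move=> n m n' m' [ab Hnm] nn mm; split=> //; exact: (Hfd a b ab).2 Hnm nn mm.
  have Gf a b : finite_set (G a b).
    have [ab|nab] := pselect (a < b)%O.
      by apply: sub_finite_set (Hfd a b ab).1 => p [].
    by apply: sub_finite_set (finite_set0 _) => p [].
  exists (edge_space theta G : topologicalType); split.
  + exact: bases_first_countable (edge_baseP G).
  + exact: edge_space_clopen_basis.
  + apply: lt_cwh_edge_space => // A /HA[f fP]; exists f => a b Aa Ab [ab].
    exact: fP.
  + apply: not_weakly_cwh_edge_space => B /HB HBf f.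
    have [a [b [Ba Bb ab Hab]]] := HBf f; exists a, b; split=> //.
    by move=> E; rewrite E ltxx in ab.
- by move=> [X [fX _ lX nX]]; exists X.
Qed.
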